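(* Let $\{x^\nu\}$ and $\{\mu_\nu\}$ be the iterates and values generated by the progressive integer programming (PIP) method, described in the context, applied to the problem (HSCOP). If $\mu_{\nu+1}=\mu_\nu$, then $x^\nu$ is a local maximizer of (HSCOP).
   Context: Let $\mathbf{1}_{[0,\infty)}(t)=1$ if $t\ge 0$ and $0$ if $t<0$. Data: a polyhedral set $P\subseteq\mathbb{R}^n$; positive integers $m$ and $J_0,J_1,\dots,J_m$; real constants $b_1,\dots,b_m$; nonnegative coefficients $\psi_{ij}$ and continuous functions $\phi_{ij}:\mathbb{R}^n\to\mathbb{R}$ for $0\le i\le m$, $1\le j\le J_i$, such that for some constant $\underline{B}$ one has $\phi_{ij}(x)\ge\underline{B}$ for all $x\in P$ and all $(i,j)$; and a Bouligand differentiable (i.e., locally Lipschitz continuous and directionally differentiable) function $\theta:\mathbb{R}^n\to\mathbb{R}$. (HSCOP): maximize $\theta(x)+\sum_{j=1}^{J_0}\psi_{0j}\,\mathbf{1}_{[0,\infty)}(\phi_{0j}(x))$ over $x\in X_{\rm AHC}$, where $$X_{\rm AHC}:=\Big\{x\in P \;\Big|\; \sum_{j=1}^{J_i}\psi_{ij}\,\mathbf{1}_{[0,\infty)}(\phi_{ij}(x))\ge b_i,\ i=1,\dots,m\Big\}.$$ Restricted problem: given a reference point $\bar{x}\in X_{\rm AHC}$ and $\varepsilon_1,\varepsilon_2\ge 0$, (R-HSCOP) at $\bar{x}$ with parameters $(\varepsilon_1,\varepsilon_2)$ is to maximize over $x\in P$ the function $\theta(x)+\sum_{j:\,\phi_{0j}(\bar{x})\ge-\varepsilon_2}\psi_{0j}\,\mathbf{1}_{[0,\infty)}(\phi_{0j}(x))$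 subject to $$\sum_{j:\,\phi_{ij}(\bar{x})\ge-\varepsilon_2}\psi_{ij}\,\mathbf{1}_{[0,\infty)}(\phi_{ij}(x))\ge b_i\ (i=1,\dots,m),\qquad \phi_{ij}(x)\ge 0\ \text{ whenever }\phi_{ij}(\bar{x})>\varepsilon_1.$$ It is equivalent to the following restricted mixed integer program. Let $\mathcal{J}^{\rm in}:=\{(i,j):-\varepsilon_2\le\phi_{ij}(\bar{x})\le\varepsilon_1\}$ and $\mathcal{J}^{>}:=\{(i,j):\phi_{ij}(\bar{x})>\varepsilon_1\}$. Maximize over $x\in P$ and $z=(z_{ij})_{(i,j)\in\mathcal{J}^{\rm in}}$ the function $\theta(x)+\sum_{(0,j)\in\mathcal{J}^{\rm in}}\psi_{0j}z_{0j}+\sum_{(0,j)\in\mathcal{J}^{>}}\psi_{0j}$ subject to $\sum_{j:(i,j)\in\mathcal{J}^{\rm in}}\psi_{ij}z_{ij}+\sum_{j:(i,j)\in\mathcal{J}^{>}}\psi_{ij}\ge b_i$ ($i=1,\dots,m$); $\phi_{ij}(x)\ge\underline{B}(1-z_{ij})$ and $z_{ij}\in\{0,1\}$ for $(i,j)\in\mathcal{J}^{\rm in}$; $\phi_{ij}(x)\ge 0$ for $(i,j)\in\mathcal{J}^{>}$. PIP method. Initialization: $x^0\in X_{\rm AHC}$, $\mu_0$ is the objective value of (HSCOP) at $x^0$, and $(\varepsilon_1^0,\varepsilon_2^0)$ is an arbitrary pair of nonnegative parameters. For $\nu=0,1,\dots$: (1) form the index sets at the reference point $x^\nu$ with parameters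 $(\varepsilon_1^\nu,\varepsilon_2^\nu)$; (2) solve the restricted mixed integer program with reference point $x^\nu$ to obtain a globally optimal solution $x^{\nu+1}$ of (R-HSCOP) at $x^\nu$ with parameters $(\varepsilon_1^\nu,\varepsilon_2^\nu)$, and let $\mu_{\nu+1}$ be the corresponding optimal objective value of (R-HSCOP); (3) if $\mu_{\nu+1}=\mu_\nu$, choose $\varepsilon_1^{\nu+1}>\varepsilon_1^\nu$ and $\varepsilon_2^{\nu+1}>\varepsilon_2^\nu$; (4) if $\mu_{\nu+1}>\mu_\nu$, choose $\varepsilon_1^{\nu+1}<\varepsilon_1^\nu$ and $\varepsilon_2^{\nu+1}<\varepsilon_2^\nu$ (parameters remaining nonnegative); (5) terminate if the values $\mu_{\nu+1}$ remain unchanged after a few consecutive enlargements of type (3). A local maximizer of (HSCOP) is a feasible point that maximizes the objective among feasible points in some neighborhood of it. *)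

(* Defs.v *)
(* MathComp-Analysis; R^n is the space of column vectors 'cV[R]_n. *)
From HB Require Import structures.
From mathcomp Require Import all_boot all_order all_algebra.
From mathcomp Require Import all_classical all_reals all_analysis.

Set Implicit Arguments.
Unset Strict Implicit.
Unset Printing Implicit Defensive.

Import Order.TTheory GRing.Theory Num.Theory.
Import numFieldNormedType.Exports.

Local Open Scope classical_set_scope.
Local Open Scope ring_scope.

Definition polyhedral (R : realType) (n : nat) (P : set 'cV[R]_n) : Prop :=
  exists (p : nat) (A : 'M[R]_(p, n)) (c : 'cV[R]_p),
    P = [set x | forall k : 'I_p, (A *m x) k 0 <= c k 0].

Definition locally_lipschitz (R : realType) (n : nat) (f : 'cV[R]_n -> R) :
    Prop :=
  forall x : 'cV[R]_n, exists2 U : set 'cV[R]_n, nbhs x U & [lipschitz f y | y in U].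

Definition directionally_differentiable (R : realType) (n : nat)
    (f : 'cV[R]_n -> R) : Prop :=
  forall x v : 'cV[R]_n, cvg ((f (x + t *: v) - f x) / t @[t --> 0^'+]).

Definition bouligand_differentiable (R : realType) (n : nat)
    (f : 'cV[R]_n -> R) : Prop :=
  locally_lipschitz f /\ directionally_differentiable f.

Definition maximizer (R : realType) (T : Type) (F : set T) (f : T -> R)
    (x : T) : Prop :=
  F x /\ forall y, F y -> f y <= f x.

Definition local_maximizer (R : realType) (n : nat) (F : set 'cV[R]_n)
    (f : 'cV[R]_n -> R) (x : 'cV[R]_n) : Prop :=
  F x /\ \forall y \near x, F y -> f y <= f x.

Definition ind_ge0 (R : realType) (t : R) : R := \1_(`[0, +oo[%classic) t.

(* Row [ord0] carries the objective terms.  The constraint numbered 1 + i, with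
   i : 'I_nc, uses row [lift ord0 i] and right-hand side [rhs i]. *)
Record hscop (R : realType) (n : nat) := HSCOP {
  dom : set 'cV[R]_n;
  nc : nat;
  J : 'I_nc.+1 -> nat;
  psi : forall i : 'I_nc.+1, 'I_(J i) -> R;
  phi : forall i : 'I_nc.+1, 'I_(J i) -> 'cV[R]_n -> R;
  rhs : 'I_nc -> R;
  lbd : R;
  theta : 'cV[R]_n -> R }.

Arguments J {R n} h i.
Arguments psi {R n} h i j.
Arguments phi {R n} h i j x.
Arguments rhs {R n} h i.
Arguments theta {R n} h x.

Record hscop_assumptions (R : realType) (n : nat) (D : hscop R n) : Prop := {
  dom_polyhedral : polyhedral (dom D);
  nc_gt0 : (0 < nc D)%N;
  J_gt0 : forall i, (0 < J D i)%N;
  psi_ge0 : forall i j, 0 <= psi D i j;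
  phi_continuous : forall i j, continuous (phi D i j);
  phi_lbd : forall i j x, dom D x -> lbd D <= phi D i j x;
  theta_bouligand : bouligand_differentiable (theta D) }.

Definition hscop_obj (R : realType) (n : nat) (D : hscop R n)
    (x : 'cV[R]_n) : R :=
  theta D x + \sum_j psi D ord0 j * ind_ge0 (phi D ord0 j x).

Definition X_AHC (R : realType) (n : nat) (D : hscop R n) : set 'cV[R]_n :=
  [set x | dom D x /\
    forall i : 'I_(nc D),
      \sum_j psi D (lift ord0 i) j * ind_ge0 (phi D (lift ord0 i) j x)
        >= rhs D i].

Definition rhscop_obj (R : realType) (n : nat) (D : hscop R n)
    (xbar : 'cV[R]_n) (e2 : R) (x : 'cV[R]_n) : R :=
  theta D x + \sum_(j | phi D ord0 j xbar >= - e2)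
    psi D ord0 j * ind_ge0 (phi D ord0 j x).

Definition rhscop_feasible (R : realType) (n : nat) (D : hscop R n)
    (xbar : 'cV[R]_n) (e1 e2 : R) : set 'cV[R]_n :=
  [set x | [/\ dom D x,
    forall i : 'I_(nc D),
      \sum_(j | phi D (lift ord0 i) j xbar >= - e2)
        psi D (lift ord0 i) j * ind_ge0 (phi D (lift ord0 i) j x) >= rhs D i
    & forall i j, phi D i j xbar > e1 -> phi D i j x >= 0]].

Definition J_in (R : realType) (n : nat) (D : hscop R n) (xbar : 'cV[R]_n)
    (e1 e2 : R) (i : 'I_(nc D).+1) (j : 'I_(J D i)) : bool :=
  - e2 <= phi D i j xbar <= e1.

Definition J_gt (R : realType) (n : nat) (D : hscop R n) (xbar : 'cV[R]_n)
    (e1 : R) (i : 'I_(nc D).+1) (j : 'I_(J D i)) : bool :=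
  phi D i j xbar > e1.

(* Only the coordinates of z indexed by [J_in] are variables of the program:
   the others are unconstrained and occur nowhere in it. *)
Definition mip_var (R : realType) (n : nat) (D : hscop R n) : Type :=
  ('cV[R]_n * (forall i : 'I_(nc D).+1, 'I_(J D i) -> R))%type.

Definition mip_obj (R : realType) (n : nat) (D : hscop R n)
    (xbar : 'cV[R]_n) (e1 e2 : R) (xz : mip_var D) : R :=
  let: (x, z) := xz in
  theta D x + \sum_(j | J_in xbar e1 e2 j) psi D ord0 j * z ord0 j
            + \sum_(j | J_gt xbar e1 j) psi D ord0 j.

Definition mip_feasible (R : realType) (n : nat) (D : hscop R n)
    (xbar : 'cV[R]_n) (e1 e2 : R) : set (mip_var D) :=
  [set xz | let: (x, z) := xz in
    [/\ dom D x,
      forall i : 'I_(nc D),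
        \sum_(j | J_in xbar e1 e2 j)
            psi D (lift ord0 i) j * z (lift ord0 i) j
          + \sum_(j | J_gt xbar e1 j) psi D (lift ord0 i) j >= rhs D i,
      forall i (j : 'I_(J D i)), J_in xbar e1 e2 j ->
        phi D i j x >= lbd D * (1 - z i j) /\ (z i j = 0 \/ z i j = 1)
      & forall i (j : 'I_(J D i)), J_gt xbar e1 j -> phi D i j x >= 0]].

(* Iteration nu produces x (nu + 1) and mu (nu + 1). *)
Definition pip_solve (R : realType) (n : nat) (D : hscop R n)
    (x : nat -> 'cV[R]_n) (mu e1 e2 : nat -> R) (nu : nat) : Prop :=
  [/\ exists z, maximizer (mip_feasible (D := D) (x nu) (e1 nu) (e2 nu))
                  (mip_obj (x nu) (e1 nu) (e2 nu)) (x nu.+1, z),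
      maximizer (rhscop_feasible D (x nu) (e1 nu) (e2 nu))
        (rhscop_obj D (x nu) (e2 nu)) (x nu.+1)
    & mu nu.+1 = rhscop_obj D (x nu) (e2 nu) (x nu.+1)].

Definition pip_update (R : realType) (mu e1 e2 : nat -> R) (nu : nat) : Prop :=
  [/\ 0 <= e1 nu.+1, 0 <= e2 nu.+1,
      mu nu.+1 = mu nu -> e1 nu < e1 nu.+1 /\ e2 nu < e2 nu.+1
    & mu nu < mu nu.+1 -> e1 nu.+1 < e1 nu /\ e2 nu.+1 < e2 nu].

(* The method stops after iteration nu: the parameters were enlarged in the q
   iterations nu - q, ..., nu - 1, and iteration nu again leaves mu unchanged. *)
Definition pip_stop (R : realType) (q : nat) (mu : nat -> R) (nu : nat) :
    Prop :=
  (q <= nu)%N /\ forall k, (nu - q <= k <= nu)%N -> mu k.+1 = mu k.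

(* Iterations 0, ..., N - 1 of the method have been carried out.  N ranges over
   all lengths of initial segments, so both finite and infinite runs are
   covered; this matters because a run can end for lack of a restricted optimal
   solution, or because a zero parameter cannot be decreased.  Values of the
   sequences beyond those generated by these iterations are irrelevant. *)
Record pip_run (R : realType) (n : nat) (D : hscop R n) (q N : nat)
    (x : nat -> 'cV[R]_n) (mu e1 e2 : nat -> R) : Prop := {
  pip_x0 : X_AHC D (x 0);
  pip_mu0 : mu 0 = hscop_obj D (x 0);
  pip_eps0 : 0 <= e1 0 /\ 0 <= e2 0;
  pip_iter : forall nu, (nu < N)%N -> pip_solve D x mu e1 e2 nu;
  pip_next : forall nu, (nu.+1 < N)%N ->
    ~ pip_stop q mu nu /\ pip_update mu e1 e2 nu }.

(* Main.v *)
(* At a reference point xbar of X_AHC the restricted sums coincide with the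
   full ones at xbar itself, and by continuity also at all points of X_AHC near
   xbar: indices dropped from a sum have phi(xbar) < - e2 <= 0, hence contribute
   nothing nearby, and the constraints added have phi(xbar) > e1 >= 0.  So a
   restricted maximizer xbar is a local maximizer.  Since psi >= 0, dropping
   terms only decreases a sum, hence
     mu_nu <= hscop_obj x^nu <= mu_(nu+1),
   and mu_(nu+1) = mu_nu makes x^nu optimal for its own restricted problem. *)
Require Import Defs.
From mathcomp Require Import all_boot all_order all_algebra.
From mathcomp Require Import all_classical all_reals all_analysis.

Set Implicit Arguments.
Unset Strict Implicit.
Unset Printing Implicit Defensive.

Import Order.TTheory GRing.Theory Num.Theory.
Import numFieldNormedType.Exports.

Local Open Scope classical_set_scope.
Local Open Scope ring_scope.

Lemma ind_ge0E (R : realType) (t : R) : ind_ge0 t = (0 <= t)%R%:R.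
Proof. by rewrite /ind_ge0 indicE mem_setE in_itv /= andbT. Qed.

Lemma restricted_sum_le (R : realType) (n : nat) (D : hscop R n)
    (D_ok : hscop_assumptions D) i (p : pred 'I_(J D i)) (y : 'cV[R]_n) :
  \sum_(j | p j) psi D i j * ind_ge0 (phi D i j y)
    <= \sum_j psi D i j * ind_ge0 (phi D i j y).
Proof.
rewrite big_mkcond /=; apply: ler_sum => j _; case: ifP => // _.
by rewrite ind_ge0E mulr_ge0 ?ler0n ?psi_ge0.
Qed.

Lemma rhscop_feasible_X_AHC (R : realType) (n : nat) (D : hscop R n)
    (D_ok : hscop_assumptions D) (xbar : 'cV[R]_n) (e1 e2 : R) :
  rhscop_feasible D xbar e1 e2 `<=` X_AHC D.
Proof.
by move=> y [Py cy _]; split=> // i; apply: le_trans (cy i) (restricted_sum_le D_ok _ _).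
Qed.

Lemma rhscop_obj_le (R : realType) (n : nat) (D : hscop R n)
    (D_ok : hscop_assumptions D) (xbar : 'cV[R]_n) (e2 : R) (y : 'cV[R]_n) :
  rhscop_obj D xbar e2 y <= hscop_obj D y.
Proof. by rewrite lerD2l; apply: restricted_sum_le. Qed.

(** Isolates what makes the restricted and full problems agree at [y]. The sign [< 0] is strict
    because [ind_ge0] is 1 at 0; indices with [phi] at [xbar] between [- e2] and [e1] impose
    nothing. *)
Definition sign_agree (R : realType) (n : nat) (D : hscop R n)
    (xbar : 'cV[R]_n) (e1 e2 : R) (y : 'cV[R]_n) : Prop :=
  forall i j, (phi D i j xbar < - e2 -> phi D i j y < 0) /\
    (e1 < phi D i j xbar -> 0 <= phi D i j y).

Lemma sign_agree_refl (R : realType) (n : nat) (D : hscop R n)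
    (xbar : 'cV[R]_n) (e1 e2 : R) (e1_ge0 : 0 <= e1) (e2_ge0 : 0 <= e2) :
  sign_agree D xbar e1 e2 xbar.
Proof.
move=> i j; split=> [/lt_le_trans|/ltW]; last exact: le_trans.
by apply; rewrite oppr_le0.
Qed.

(** Since [e1] and [e2] are nonnegative, each premise forces a strict sign at [xbar], which persists
    nearby by continuity; the pairs [(i, j)] being finitely many, one neighborhood serves them
    all. *)
Lemma near_sign_agree (R : realType) (n : nat) (D : hscop R n)
    (D_ok : hscop_assumptions D) (xbar : 'cV[R]_n) (e1 e2 : R)
    (e1_ge0 : 0 <= e1) (e2_ge0 : 0 <= e2) :
  \forall y \near xbar, sign_agree D xbar e1 e2 y.
Proof.
apply: (filter_forall (nbhs_filter xbar)) => i.
apply: (filter_forall (nbhs_filter xbar)) => j.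
have phiC : phi D i j y @[y --> xbar] --> phi D i j xbar.
  exact: phi_continuous D_ok i j xbar.
have [xlt|xge] := ltP (phi D i j xbar) (- e2).
  have xlt0 : phi D i j xbar < 0 by apply: lt_le_trans xlt _; rewrite oppr_le0.
  apply: filterS (cvgr_lt (phi D i j xbar) phiC _ xlt0) => y ylt0.
  by split=> // /(le_lt_trans e1_ge0)/lt_trans/(_ xlt0); rewrite ltxx.
have [xgt|xle] := ltP e1 (phi D i j xbar); last first.
  (* Between the thresholds both implications are vacuous, so every [y] qualifies. *)
  by apply: nearW => y; split=> //; rewrite ltNge ?xle ?xge.
apply: filterS (cvgr_gt (phi D i j xbar) phiC _ (le_lt_trans e1_ge0 xgt)) => y.
by move=> /ltW ygt0; split=> //; rewrite ltNge xge.
Qed.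

Lemma restricted_sumE (R : realType) (n : nat) (D : hscop R n)
    (xbar : 'cV[R]_n) (e1 e2 : R) (y : 'cV[R]_n) i :
  sign_agree D xbar e1 e2 y ->
  \sum_(j | phi D i j xbar >= - e2) psi D i j * ind_ge0 (phi D i j y)
    = \sum_j psi D i j * ind_ge0 (phi D i j y).
Proof.
move=> sy; rewrite big_mkcond; apply: eq_bigr => j _.
case: leP => // /(proj1 (sy i j)) ylt0.
by rewrite ind_ge0E leNgt ylt0 mulr0.
Qed.

Lemma rhscop_objE (R : realType) (n : nat) (D : hscop R n)
    (xbar : 'cV[R]_n) (e1 e2 : R) (y : 'cV[R]_n) :
  sign_agree D xbar e1 e2 y -> rhscop_obj D xbar e2 y = hscop_obj D y.
Proof. by move=> sy; rewrite /rhscop_obj (restricted_sumE _ sy). Qed.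

Lemma X_AHC_rhscop_feasible (R : realType) (n : nat) (D : hscop R n)
    (xbar : 'cV[R]_n) (e1 e2 : R) (y : 'cV[R]_n) :
  sign_agree D xbar e1 e2 y -> X_AHC D y -> rhscop_feasible D xbar e1 e2 y.
Proof.
move=> sy [Py cy]; split=> // [i|i j]; last by have [] := sy i j.
by rewrite (restricted_sumE _ sy).
Qed.

Lemma rhscop_maximizer_local (R : realType) (n : nat) (D : hscop R n)
    (D_ok : hscop_assumptions D) (xbar : 'cV[R]_n) (e1 e2 : R)
    (e1_ge0 : 0 <= e1) (e2_ge0 : 0 <= e2) :
  maximizer (rhscop_feasible D xbar e1 e2) (rhscop_obj D xbar e2) xbar ->
  local_maximizer (X_AHC D) (hscop_obj D) xbar.
Proof.
move=> [Fx xmax]; split; first exact: rhscop_feasible_X_AHC Fx.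
have sx : sign_agree D xbar e1 e2 xbar by exact: sign_agree_refl.
apply: filterS (near_sign_agree D_ok xbar e1_ge0 e2_ge0) => y sy Xy.
rewrite -(rhscop_objE sx) -(rhscop_objE sy).
exact/xmax/X_AHC_rhscop_feasible.
Qed.

(** Invariants of the run. For [nu > 0] the last bound can be strict: [mu nu] is a restricted value
    at the previous reference point, whose sum may omit terms that are positive at [x nu]. *)
Lemma pip_iterate (R : realType) (n : nat) (D : hscop R n)
    (D_ok : hscop_assumptions D) (q N : nat)
    (x : nat -> 'cV[R]_n) (mu e1 e2 : nat -> R)
    (run : pip_run D q N x mu e1 e2) (nu : nat) (nuN : (nu < N)%N) :
  [/\ 0 <= e1 nu, 0 <= e2 nu, X_AHC D (x nu) & mu nu <= hscop_obj D (x nu)].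
Proof.
case: nu nuN => [_|nu nuN].
  by have [? ?] := pip_eps0 run; split=> //; [apply: pip_x0 run|rewrite (pip_mu0 run)].
have [_ [? ? _ _]] := pip_next run nuN.
have [_ [Fx _] ->] := pip_iter run (ltnW nuN).
by split=> //; [apply: rhscop_feasible_X_AHC Fx|apply: rhscop_obj_le].
Qed.

Theorem proposition5 (R : realType) (n : nat) (D : hscop R n)
    (D_ok : hscop_assumptions D)
    (q N : nat) (q_gt0 : (0 < q)%N)
    (x : nat -> 'cV[R]_n) (mu e1 e2 : nat -> R)
    (run : pip_run D q N x mu e1 e2)
    (nu : nat) (nuN : (nu < N)%N) (mu_eq : mu nu.+1 = mu nu) :
  local_maximizer (X_AHC D) (hscop_obj D) (x nu).
Proof.
have [e1_ge0 e2_ge0 Xx mu_le] := pip_iterate D_ok run nuN.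
have [_ [_ xmax] muS] := pip_iter run nuN.
have sx : sign_agree D (x nu) (e1 nu) (e2 nu) (x nu) by exact: sign_agree_refl.
apply: rhscop_maximizer_local e1_ge0 e2_ge0 _ => //.
split=> [|y Fy]; first exact: X_AHC_rhscop_feasible.
(* Optimality is known at [x nu.+1] only; it passes to [x nu] because
   [mu nu.+1 = mu nu <= hscop_obj D (x nu)], and by [sx] the latter is the restricted value at
   [x nu]. *)
apply: le_trans (xmax y Fy) _.
by rewrite -muS mu_eq (rhscop_objE sx).
Qed.
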